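(* Let $(A,\cdot)$ be an associative algebra, $(V,l,r)$ a bimodule of $(A,\cdot)$, and $T:V\to A$ an anti-$\mathcal O$-operator of $(A,\cdot)$ associated to $(V,l,r)$. Define bilinear operations on $V$ by $$u\vartriangleright v=-l(T(u))v,\qquad u\vartriangleleft v=-r(T(v))u,\qquad \forall u,v\in V,$$ and put $u\cdot v=u\vartriangleright v+u\vartriangleleft v$. Then: (1) For all $u,v,w\in V$, $$u\vartriangleright(v\vartriangleright w)=-(u\cdot v)\vartriangleright w,\quad (u\vartriangleleft v)\vartriangleleft w=-u\vartriangleleft(v\cdot w),\quad (u\vartriangleright v)\vartriangleleft w=u\vartriangleright(v\vartriangleleft w).$$ (2) $(V,\vartriangleright,\vartriangleleft)$ is an anti-dendriform algebra if and only if $T$ is strong. In this case, $T$ is a homomorphism of associative algebras from $(V,\cdot)$ to $(A,\cdot)$; furthermore, there is an induced anti-dendriform algebra structure on $T(V)=\{T(u)\mid u\in V\}\subseteq A$ given by $$T(u)\vartriangleright T(v)=T(u\vartriangleright v),\qquad T(u)\vartriangleleft T(v)=T(u\vartriangleleft v),\qquad \forall u,v\in V,$$ and $T$ is a homomorphism of anti-dendriform algebras.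
   Context: All vector spaces are finite-dimensional over a field $\mathbb F$ of characteristic $0$. Associative algebras are not assumed to be unital. Bimodule of an associative algebra $(A,\cdot)$: a triple $(V,l,r)$ with $V$ a vector space and $l,r:A\to\mathrm{End}_{\mathbb F}(V)$ linear maps such that $l(x\cdot y)v=l(x)(l(y)v)$, $r(x\cdot y)v=r(y)(r(x)v)$, $l(x)(r(y)v)=r(y)(l(x)v)$ for all $x,y\in A$, $v\in V$. Anti-$\mathcal O$-operator of $(A,\cdot)$ associated to $(V,l,r)$: a linear map $T:V\to A$ with $T(u)\cdot T(v)=-T\big(l(T(u))v+r(T(v))u\big)$ for all $u,v\in V$. It is strong if moreover $l(T(u)\cdot T(v))w=r(T(v)\cdot T(w))u$ for all $u,v,w\in V$. Anti-dendriform algebra: a vector space $B$ with two bilinear operations $\vartriangleright,\vartriangleleft$ such that, with $x\cdot y=x\vartriangleright y+x\vartriangleleft y$, for all $x,y,z\in B$, $$x\vartriangleright(y\vartriangleright z)=-(x\cdot y)\vartriangleright z=-x\vartriangleleft(y\cdot z)=(x\vartriangleleft y)\vartriangleleft z,\qquad (x\vartriangleright y)\vartriangleleft z=x\vartriangleright(y\vartriangleleft z).$$ In that case $(B,\cdot)$ is associative and is called the associated associative algebra. Homomorphisms of anti-dendriform algebras are linear maps preserving both operations. *)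

(* Defs.v *)
From HB Require Import structures.
From mathcomp Require Import all_boot all_order all_algebra.
Set Implicit Arguments.
Unset Strict Implicit.
Unset Printing Implicit Defensive.
Import GRing.Theory.
Local Open Scope ring_scope.

(* MathComp's algebra structures are unital, so a not necessarily unital
   associative algebra is a vector space with an associative bilinear product. *)

Definition is_bimodule (F : fieldType) (A V : vectType F)
    (mul : {bilinear A -> A -> A}) (l r : 'Hom(A, 'End(V))) : Prop :=
  [/\ forall x y v, l (mul x y) v = l x (l y v),
      forall x y v, r (mul x y) v = r y (r x v) &
      forall x y v, l x (r y v) = r y (l x v)].

Definition is_antiO_operator (F : fieldType) (A V : vectType F)
    (mul : {bilinear A -> A -> A}) (l r : 'Hom(A, 'End(V)))
    (T : 'Hom(V, A)) : Prop :=
  forall u v : V, mul (T u) (T v) = - T (l (T u) v + r (T v) u).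

(* The extra condition making an anti-O-operator a strong one. *)
Definition strong (F : fieldType) (A V : vectType F)
    (mul : {bilinear A -> A -> A}) (l r : 'Hom(A, 'End(V)))
    (T : 'Hom(V, A)) : Prop :=
  forall u v w : V, l (mul (T u) (T v)) w = r (mul (T v) (T w)) u.

Definition add_op (F : fieldType) (B : vectType F)
    (rt lt : {bilinear B -> B -> B}) (x y : B) : B := rt x y + lt x y.

Lemma add_op_bilinear (F : fieldType) (B : vectType F)
    (rt lt : {bilinear B -> B -> B}) :
  bilinear_for *:%R *:%R (add_op rt lt).
Proof.
by split=> z a x y /=;
  rewrite /add_op ?(linearPl rt) ?(linearPl lt) ?linearPr scalerDr addrACA.
Qed.

HB.instance Definition _ (F : fieldType) (B : vectType F)
    (rt lt : {bilinear B -> B -> B}) :=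
  bilinear_isBilinear.Build F B B B *:%R *:%R (add_op rt lt)
    (add_op_bilinear rt lt).

Definition is_antidendriform (F : fieldType) (B : vectType F)
    (rt lt : {bilinear B -> B -> B}) : Prop :=
  forall x y z : B,
    [/\ rt x (rt y z) = - rt (add_op rt lt x y) z,
        - rt (add_op rt lt x y) z = - lt x (add_op rt lt y z),
        - lt x (add_op rt lt y z) = lt (lt x y) z &
        lt (rt x y) z = rt x (lt y z)].

Definition preserves (F : fieldType) (B C : vectType F)
    (opB : {bilinear B -> B -> B}) (opC : {bilinear C -> C -> C})
    (f : 'Hom(B, C)) : Prop :=
  forall x y : B, f (opB x y) = opC (f x) (f y).

Definition is_antidendriform_hom (F : fieldType) (B C : vectType F)
    (rtB ltB : {bilinear B -> B -> B}) (rtC ltC : {bilinear C -> C -> C})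
    (f : 'Hom(B, C)) : Prop :=
  preserves rtB rtC f /\ preserves ltB ltC f.

Definition op_rt (F : fieldType) (A V : vectType F)
    (l : 'Hom(A, 'End(V))) (T : 'Hom(V, A)) (u v : V) : V := - l (T u) v.

Definition op_lt (F : fieldType) (A V : vectType F)
    (r : 'Hom(A, 'End(V))) (T : 'Hom(V, A)) (u v : V) : V := - r (T v) u.

Lemma op_rt_bilinear (F : fieldType) (A V : vectType F)
    (l : 'Hom(A, 'End(V))) (T : 'Hom(V, A)) :
  bilinear_for *:%R *:%R (op_rt l T).
Proof.
split=> z a x y; rewrite /= /op_rt.
  by rewrite !linearP add_lfunE scale_lfunE opprD scalerN.
by rewrite linearP opprD scalerN.
Qed.

Lemma op_lt_bilinear (F : fieldType) (A V : vectType F)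
    (r : 'Hom(A, 'End(V))) (T : 'Hom(V, A)) :
  bilinear_for *:%R *:%R (op_lt r T).
Proof.
split=> z a x y; rewrite /= /op_lt.
  by rewrite linearP opprD scalerN.
by rewrite !linearP add_lfunE scale_lfunE opprD scalerN.
Qed.

HB.instance Definition _ (F : fieldType) (A V : vectType F)
    (l : 'Hom(A, 'End(V))) (T : 'Hom(V, A)) :=
  bilinear_isBilinear.Build F V V V *:%R *:%R (op_rt l T) (op_rt_bilinear l T).

HB.instance Definition _ (F : fieldType) (A V : vectType F)
    (r : 'Hom(A, 'End(V))) (T : 'Hom(V, A)) :=
  bilinear_isBilinear.Build F V V V *:%R *:%R (op_lt r T) (op_lt_bilinear r T).

(* T with codomain restricted to its image T(V), the latter being a vector
   space in its own right: subvs_of (limg T). *)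
Definition corestr (F : fieldType) (V A : vectType F) (T : 'Hom(V, A)) :
    'Hom(V, subvs_of (limg T)) :=
  linfun (vsproj (limg T) \o T).

Lemma vsval_corestr (F : fieldType) (V A : vectType F) (T : 'Hom(V, A)) u :
  vsval (corestr T u) = T u.
Proof. by rewrite lfunE /= vsprojK // memv_img ?memvf. Qed.

(* Main.v *)
From HB Require Import structures.
Require Import Defs.
From mathcomp Require Import all_boot all_order all_algebra.
Set Implicit Arguments.
Unset Strict Implicit.
Unset Printing Implicit Defensive.
Import GRing.Theory.
Local Open Scope ring_scope.

(** The anti-O-operator equation says exactly that [T] is multiplicative for
    [dot] ([antiO_preserves]).  Hence [l (T (dot u v))] is [l (T u * T v)],
    and likewise for [r], so the three identities that hold for every
    anti-O-operator are the three bimodule axioms read through [T].  Of the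
    anti-dendriform axioms only [rt (dot u v) w = lt u (dot v w)] is then left,
    and it unfolds to [l (T u * T v) w = r (T v * T w) u], that is, to strength
    ([antidendriform_strong]).  Associativity of [dot] is a property of all
    anti-dendriform algebras ([antidendriform_assoc]).

    For the structure on [T(V)], the issue is whether [T (rt u v)] and
    [T (lt u v)] depend only on [T u] and [T v], i.e. whether the kernel of [T]
    is a two-sided ideal for both operations ([antiO_ker_ideal_rt],
    [antiO_ker_ideal_lt]).  On one side this is clear, since [rt u v] uses [u]
    only through [T u]; on the other side, if [T v = 0], the anti-O-operator
    equation gives [T (rt u v) = T u * T v - T (lt u v)], both terms of which
    vanish.  The induced operations are then computed on preimages
    ([induced_op]), and the axioms pass to the image because the corestriction
    of [T] is a surjective homomorphism ([antidendriform_surj]). *)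

(** The common value [a] of [rt (x y) z] and [lt x (y z)] cancels: it enters
    [(x y) z] through [rt (x y) z = a] and [lt (lt x y) z = - a], and [x (y z)]
    through [lt x (y z) = a] and [rt x (rt y z) = - a].  Both products reduce
    to [lt (rt x y) z = rt x (lt y z)]. *)
Lemma antidendriform_assoc (F : fieldType) (B : vectType F)
    (rt lt : {bilinear B -> B -> B}) :
  is_antidendriform rt lt -> associative (add_op rt lt).
Proof.
move=> ad x y z; have [e1 e2 e3 e4] := ad x y z.
rewrite /= /add_op in e1 e2 e3 e4 *.
rewrite (linearDr rt) (linearDl lt) e1 -e4.
by rewrite -e3 -e2 (oppr_inj e2) addrC addrA subrr add0r addrCA subrr addr0.
Qed.

(** The anti-dendriform axioms are identities, so they pass to homomorphic
    images. *)
Lemma antidendriform_surj (F : fieldType) (B C : vectType F)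
    (rtB ltB : {bilinear B -> B -> B}) (rtC ltC : {bilinear C -> C -> C})
    (f : 'Hom(B, C)) :
  (forall y, exists x, f x = y) ->
  is_antidendriform_hom rtB ltB rtC ltC f ->
  is_antidendriform rtB ltB -> is_antidendriform rtC ltC.
Proof.
move=> surj [fr fl] ad a b c.
have [[[x <-] [y <-]] [z <-]] := (surj a, surj b, surj c).
have fdot u v : add_op rtC ltC (f u) (f v) = f (add_op rtB ltB u v).
  by rewrite /add_op linearD -fr -fl.
have [e1 e2 e3 e4] := ad x y z.
by rewrite !fdot -!fr -!fl -!fr -!(linearN f) /= e1 e2 e3 e4.
Qed.

Lemma corestr_surj (F : fieldType) (V A : vectType F) (T : 'Hom(V, A)) y :
  exists x, corestr T x = y.
Proof.
have /memv_imgP [x _ Dy] := subvsP y.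
by exists x; apply: val_inj; rewrite /= vsval_corestr Dy.
Qed.

(** [T^-1] is a linear choice of preimages on the image of [T], which makes
    bilinearity immediate. *)
Definition induced_op (F : fieldType) (V A : vectType F) (T : 'Hom(V, A))
    (op : {bilinear V -> V -> V}) (x y : subvs_of (limg T)) :
    subvs_of (limg T) :=
  corestr T (op ((T^-1)%VF (vsval x)) ((T^-1)%VF (vsval y))).

Arguments induced_op {F V A} T op x y.

Lemma induced_op_bilinear (F : fieldType) (V A : vectType F) (T : 'Hom(V, A))
    (op : {bilinear V -> V -> V}) :
  bilinear_for *:%R *:%R (induced_op T op).
Proof.
split=> z a x y; rewrite /= /induced_op.
  rewrite !(linearP vsval, linearP T^-1%VF).
  by rewrite (linearPl op) linearP.
by rewrite !(linearP vsval, linearP T^-1%VF) linearPr linearP.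
Qed.

HB.instance Definition _ (F : fieldType) (V A : vectType F) (T : 'Hom(V, A))
    (op : {bilinear V -> V -> V}) :=
  bilinear_isBilinear.Build F _ _ _ *:%R *:%R (induced_op T op)
    (induced_op_bilinear T op).

Definition ker_ideal (F : fieldType) (V A : vectType F) (T : 'Hom(V, A))
    (op : {bilinear V -> V -> V}) : Prop :=
  forall u v : V, T u = 0 -> T (op u v) = 0 /\ T (op v u) = 0.

(** Quotient principle: when the kernel of [T] is an ideal, [T (op u v)] does
    not change if [u] and [v] are replaced by the chosen preimages of [T u] and
    [T v]. *)
Lemma induced_op_preserves (F : fieldType) (V A : vectType F)
    (T : 'Hom(V, A)) (op : {bilinear V -> V -> V}) :
  ker_ideal T op -> preserves op (induced_op T op) (corestr T).
Proof.
move=> idl u v; apply: val_inj; rewrite /= /induced_op !vsval_corestr.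
set u' := (T^-1)%VF (T u); set v' := (T^-1)%VF (T v).
have kerB w : T (w - (T^-1)%VF (T w)) = 0.
  by rewrite linearB /= limg_lfunVK ?subrr // memv_img ?memvf.
(* The arguments are replaced one at a time, through [op u' v]. *)
have [+ _] := idl _ v (kerB u); have [_ +] := idl _ u' (kerB v).
rewrite -/u' -/v' linearBr linearBl !linearB /= => /subr0_eq <- /subr0_eq.
by [].
Qed.

Section AntiOOperator.

Variables (F : fieldType) (A V : vectType F) (mul : {bilinear A -> A -> A}).
Variables (l r : 'Hom(A, 'End(V))) (T : 'Hom(V, A)).
Hypothesis antiO : is_antiO_operator mul l r T.

Lemma antiO_preserves : preserves (add_op (op_rt l T) (op_lt r T)) mul T.
Proof.
by move=> u v; rewrite antiO /= /add_op /= /op_rt /op_lt -opprD linearN.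
Qed.

Lemma antiO_mul u v : mul (T u) (T v) = T (op_rt l T u v) + T (op_lt r T u v).
Proof. by rewrite -antiO_preserves /add_op linearD. Qed.

(** [op_rt l T u v] vanishes when [T u = 0].  When [T v = 0], both the product
    [mul (T u) (T v)] and [op_lt r T u v] vanish, so the remaining term
    [T (op_rt l T u v)] of [antiO_mul] does too. *)
Lemma antiO_ker_ideal_rt : ker_ideal T (op_rt l T).
Proof.
move=> u v Tu0; split; first
  by rewrite /= /op_rt Tu0 linear0 lfunE /= oppr0 linear0.
have := antiO_mul v u.
by rewrite Tu0 linear0r /op_lt Tu0 linear0 lfunE /= oppr0 linear0 addr0.
Qed.

Lemma antiO_ker_ideal_lt : ker_ideal T (op_lt r T).
Proof.
move=> u v Tu0; split; last
  by rewrite /= /op_lt Tu0 linear0 lfunE /= oppr0 linear0.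
have := antiO_mul u v.
by rewrite Tu0 linear0l /op_rt Tu0 linear0 lfunE /= oppr0 linear0 add0r.
Qed.

Hypothesis bimod : is_bimodule mul l r.

(** Each identity is one bimodule axiom, the two minus signs of the nested
    operations cancelling. *)
Lemma antiO_identities u v w :
  [/\ op_rt l T u (op_rt l T v w)
         = - op_rt l T (add_op (op_rt l T) (op_lt r T) u v) w,
      op_lt r T (op_lt r T u v) w
         = - op_lt r T u (add_op (op_rt l T) (op_lt r T) v w) &
      op_lt r T (op_rt l T u v) w = op_rt l T u (op_lt r T v w)].
Proof.
have [lM rM lr] := bimod.
(* Unfolding the outer operations first exposes [T] applied to the product. *)
rewrite [op_rt l T (add_op _ _ _ _) _]/op_rt.
rewrite [op_lt r T u (add_op _ _ _ _)]/op_lt.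
by rewrite !antiO_preserves /op_rt /op_lt !linearN /= !opprK lM rM lr.
Qed.

(** Given [antiO_identities], the only remaining axiom is
    [rt (u v) w = lt u (v w)], which is strength up to sign. *)
Lemma antidendriform_strong :
  is_antidendriform (op_rt l T) (op_lt r T) <-> strong mul l r T.
Proof.
have mid u v w : (op_rt l T (add_op (op_rt l T) (op_lt r T) u v) w
    = - l (mul (T u) (T v)) w) *
    (op_lt r T u (add_op (op_rt l T) (op_lt r T) v w)
    = - r (mul (T v) (T w)) u).
  by rewrite /op_rt /op_lt !antiO_preserves.
split=> [ad | st] u v w.
  by have [_ + _ _] := ad u v w; rewrite /= !mid !opprK.
have [e1 e2 e3] := antiO_identities u v w.
by split; rewrite //= !mid st.
Qed.

End AntiOOperator.

Theorem proposition2p18 (F : fieldType) (charF0 : [pchar F] =i pred0)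
    (A V : vectType F)
    (mul : {bilinear A -> A -> A}) (mul_assoc : associative mul)
    (l r : 'Hom(A, 'End(V))) (bimod : is_bimodule mul l r)
    (T : 'Hom(V, A)) (antiO : is_antiO_operator mul l r T) :
  let rt : {bilinear V -> V -> V} := op_rt l T in
  let lt : {bilinear V -> V -> V} := op_lt r T in
  let dot : {bilinear V -> V -> V} := add_op rt lt in
  (forall u v w : V,
     [/\ rt u (rt v w) = - rt (dot u v) w,
         lt (lt u v) w = - lt u (dot v w) &
         lt (rt u v) w = rt u (lt v w)]) /\
  (is_antidendriform rt lt <-> strong mul l r T) /\
  (strong mul l r T ->
     [/\ associative dot,
         preserves dot mul T &
         exists rtT ltT : {bilinear subvs_of (limg T) -> subvs_of (limg T)
                                                      -> subvs_of (limg T)},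
           [/\ is_antidendriform rtT ltT,
               forall u v : V,
                 vsval (rtT (corestr T u) (corestr T v)) = T (rt u v),
               forall u v : V,
                 vsval (ltT (corestr T u) (corestr T v)) = T (lt u v) &
               is_antidendriform_hom rt lt rtT ltT (corestr T)]]).
Proof.
move=> rt lt dot; split; first exact: antiO_identities antiO bimod.
have ad_strong := antidendriform_strong antiO bimod.
split=> // /ad_strong ad.
split; [exact: antidendriform_assoc | exact: antiO_preserves antiO |].
have prt := induced_op_preserves (antiO_ker_ideal_rt antiO).
have plt := induced_op_preserves (antiO_ker_ideal_lt antiO).
exists (induced_op T rt), (induced_op T lt); split=> //.
- exact: (antidendriform_surj (@corestr_surj _ _ _ T) (conj prt plt)).
- by move=> u v; rewrite -prt vsval_corestr.
- by move=> u v; rewrite -plt vsval_corestr.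
Qed.
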